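(* Let $\lambda\in\mathbb R$ and $\gamma>1$, and consider a polytropic gas in the duct $\Omega=(0,l)\times(0,\pi)$. Let $L^1,L^2,L^3,L_1,L_2$ be smooth functions with $L^j(0)=0$ ($j=1,2,3$) and $L_n(0)=0$ ($n=1,2$). Suppose $p,\rho,\mathbf u=(u,v)^\top,m\in C^2(\Omega)\cap C^1(\bar\Omega)$ with $\rho>0$, $u>0$ in $\bar\Omega$, and let $k=k(x)\in C^1([0,l])$ be an auxiliary function. Write $$\mathcal E=\mathrm D_{\mathbf u}E+\lambda mE,\qquad \mathcal A=\mathrm D_{\mathbf u}A(s)+\lambda\gamma m\Big[1-\tfrac{\gamma-1}{2}M^2\Big]A(s),$$ $$\mathcal V=\partial_yv+\frac{\mathrm D_{\mathbf u}p}{\gamma p}-\lambda m\Big[1+\tfrac{(\gamma-1)M^2}{2}\Big]-\frac1u\Big[v\,\partial_yu+\frac1\rho\partial_xp\Big].$$ Consider the coupled problems: (a) $\mathcal E=0$ in $\Omega$, $E=E_0(y)$ on $\Sigma_0$; (b) $\mathcal A=0$ in $\Omega$, $A(s)=A(s_0)(y)$ on $\Sigma_0$; (c) $\mathcal V+k(x)=0$ in $\Omega$, $v=v_0(y)$ on $\Sigma_0$, $v=0$ on $W_-\cup W_+$; (d) in $\Omega$, $$\mathrm D_{\mathbf u}\Big[\frac{\mathrm D_{\mathbf u}p}{\gamma p}\Big]-\mathrm{div}\Big[\frac{\nabla p}{\rho}\Big]-\Big[(\partial_xu)^2+2\partial_yu\,\partial_xv+(\partial_yv)^2\Big]-\frac{\lambda(\gamma-1)}2\mathrm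 D_{\mathbf u}[mM^2]-\lambda\,\mathrm{div}[m\mathbf u]+L^1(\mathcal E)+L^2(\mathcal A)+L^3(\mathcal V+k)=0,$$ together with $\mathcal V+L_1(\mathcal E)+L_2(\mathcal A)=0$ on $\Sigma_0$, $p=p_l(y)$ on $\Sigma_l$, and $\partial_yp=0$ on $W_-\cup W_+$. If $p,\rho,\mathbf u,m,k$ satisfy (a)–(d), then $k\equiv0$ and $(p,\rho,\mathbf u)$ solves the boundary value problem (P): $$\mathrm{div}(\rho\mathbf u\otimes\mathbf u)+\nabla p=0,\quad \mathrm{div}(\rho\mathbf u)=\lambda\rho m,\quad \mathrm{div}(\rho E\mathbf u)=0\quad\text{in }\Omega,$$ $E=E_0(y)$, $s=s_0(y)$, $v=v_0(y)$ on $\Sigma_0$; $p=p_l(y)$ on $\Sigma_l$; $v=0$ on $W_\pm$. Conversely, for given $\lambda\in\mathbb R$ and $m\in C^2(\Omega)\cap C^1(\bar\Omega)$, any solution $p,\rho,\mathbf u\in C^2(\Omega)\cap C^1(\bar\Omega)$ of (P) with $\rho>0$, $u>0$ is a solution of the coupled problems (a)–(d) with $k\equiv0$.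
   Context: Geometry: $\Sigma_0=\{(0,y):0<y<\pi\}$, $\Sigma_l=\{(l,y):0<y<\pi\}$, $W_-=\{(x,0):0<x<l\}$, $W_+=\{(x,\pi):0<x<l\}$. Gas: $p=A(s)\rho^\gamma$ with $p>0$, where $A(s)=\kappa_0\exp(s/c_\nu)$, $\kappa_0,c_\nu>0$ constants, $s$ is the entropy; $c=\sqrt{\gamma p/\rho}$, $M=|\mathbf u|/c$, and $E=\frac12|\mathbf u|^2+\frac{c^2}{\gamma-1}$ is the total enthalpy. For a function $f$, $\mathrm D_{\mathbf u}f=\mathbf u\cdot\nabla f$. The functions $E_0,s_0,v_0,p_l$ on $[0,\pi]$ are given boundary data, and $A(s_0)(y)=A(s_0(y))$. *)

(* Defs.v *)
From Stdlib Require Export Reals.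
From Coquelicot Require Export Coquelicot.
Open Scope R_scope.

(* Scalar fields are total functions on the plane; only their values on the
   closed duct are ever used. *)
Definition field := R * R -> R.

Definition Omega (l : R) (z : R * R) : Prop :=
  0 < fst z < l /\ 0 < snd z < PI.
Definition Omega_bar (l : R) (z : R * R) : Prop :=
  0 <= fst z <= l /\ 0 <= snd z <= PI.

Definition Sigma_0 (z : R * R) : Prop := fst z = 0 /\ 0 < snd z < PI.
Definition Sigma_l (l : R) (z : R * R) : Prop := fst z = l /\ 0 < snd z < PI.
Definition W_minus (l : R) (z : R * R) : Prop := 0 < fst z < l /\ snd z = 0.
Definition W_plus (l : R) (z : R * R) : Prop := 0 < fst z < l /\ snd z = PI.

Definition dx (f : field) : field :=
  fun z => Derive (fun t => f (t, snd z)) (fst z).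
Definition dy (f : field) : field :=
  fun z => Derive (fun t => f (fst z, t)) (snd z).
Definition ex_dx (f : field) (z : R * R) : Prop :=
  ex_derive (fun t => f (t, snd z)) (fst z).
Definition ex_dy (f : field) (z : R * R) : Prop :=
  ex_derive (fun t => f (fst z, t)) (snd z).
Definition divergence (f g : field) : field := fun z => dx f z + dy g z.

(* [D] is meant to be open. *)
Fixpoint Ck (D : R * R -> Prop) (n : nat) (f : field) : Prop :=
  continuous_on D f /\
  match n with
  | O => True
  | S n' => (forall z, D z -> ex_dx f z /\ ex_dy f z) /\
            Ck D n' (dx f) /\ Ck D n' (dy f)
  end.

Definition extends_to_closure (l : R) (g : field) : Prop :=
  exists h : field, continuous_on (Omega_bar l) h /\
    forall z, Omega l z -> h z = g z.

Definition C1_bar (l : R) (f : field) : Prop :=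
  Ck (Omega l) 1 f /\ continuous_on (Omega_bar l) f /\
  extends_to_closure l (dx f) /\ extends_to_closure l (dy f).

Definition C2_C1_bar (l : R) (f : field) : Prop :=
  Ck (Omega l) 2 f /\ C1_bar l f.

Definition C1_interval (l : R) (k : R -> R) : Prop :=
  continuous_on (fun x => 0 <= x <= l) k /\
  exists dk : R -> R, continuous_on (fun x => 0 <= x <= l) dk /\
    forall x, 0 < x < l -> is_derive k x (dk x).

Definition smooth (f : R -> R) : Prop := forall n x, ex_derive_n f n x.

(* The value at the boundary point [z] of the continuous extension of [g] from
   the open duct is [a].  Expressions containing derivatives are evaluated on
   the boundary in this sense, since [Derive] there would depend on the values
   taken outside the closed duct. *)
Definition boundary_value (l : R) (g : field) (z : R * R) (a : R) : Prop :=
  filterlim g (within (Omega l) (locally z)) (locally a).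

Record gas := Gas { gamma : R; kappa0 : R; cnu : R }.

Definition A_of (G : gas) (s : R) : R := kappa0 G * exp (s / cnu G).

Record flow := Flow {
  pres : field;
  rho : field;
  entr : field;
  vx : field;
  vy : field }.

Definition state_equation (l : R) (G : gas) (w : flow) : Prop :=
  forall z, Omega_bar l z ->
    pres w z = A_of G (entr w z) * Rpower (rho w z) (gamma G).

Definition admissible (l : R) (G : gas) (w : flow) : Prop :=
  C2_C1_bar l (pres w) /\ C2_C1_bar l (rho w) /\
  C2_C1_bar l (vx w) /\ C2_C1_bar l (vy w) /\
  (forall z, Omega_bar l z -> 0 < pres w z /\ 0 < rho w z /\ 0 < vx w z) /\
  state_equation l G w.

Definition speed (w : flow) : field := fun z => sqrt (vx w z ^ 2 + vy w z ^ 2).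
Definition sound (G : gas) (w : flow) : field :=
  fun z => sqrt (gamma G * pres w z / rho w z).
Definition mach (G : gas) (w : flow) : field :=
  fun z => speed w z / sound G w z.
Definition enthalpy (G : gas) (w : flow) : field :=
  fun z => / 2 * speed w z ^ 2 + sound G w z ^ 2 / (gamma G - 1).
Definition A_field (G : gas) (w : flow) : field := fun z => A_of G (entr w z).

Definition Du (w : flow) (f : field) : field :=
  fun z => vx w z * dx f z + vy w z * dy f z.

Definition Du_log_p (G : gas) (w : flow) : field :=
  fun z => Du w (pres w) z / (gamma G * pres w z).

Definition resE (G : gas) (lam : R) (w : flow) (m : field) : field :=
  fun z => Du w (enthalpy G w) z + lam * m z * enthalpy G w z.

Definition resA (G : gas) (lam : R) (w : flow) (m : field) : field :=
  fun z => Du w (A_field G w) z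
    + lam * gamma G * m z * (1 - (gamma G - 1) / 2 * mach G w z ^ 2)
      * A_field G w z.

Definition resV (G : gas) (lam : R) (w : flow) (m : field) : field :=
  fun z => dy (vy w) z + Du_log_p G w z
    - lam * m z * (1 + (gamma G - 1) * mach G w z ^ 2 / 2)
    - / vx w z * (vy w z * dy (vx w) z + / rho w z * dx (pres w) z).

Definition problem_a (l : R) (G : gas) (lam : R) (E0 : R -> R)
    (w : flow) (m : field) : Prop :=
  (forall z, Omega l z -> resE G lam w m z = 0) /\
  (forall z, Sigma_0 z -> enthalpy G w z = E0 (snd z)).

Definition problem_b (l : R) (G : gas) (lam : R) (s0 : R -> R)
    (w : flow) (m : field) : Prop :=
  (forall z, Omega l z -> resA G lam w m z = 0) /\
  (forall z, Sigma_0 z -> A_field G w z = A_of G (s0 (snd z))).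

Definition problem_c (l : R) (G : gas) (lam : R) (v0 : R -> R)
    (w : flow) (m : field) (k : R -> R) : Prop :=
  (forall z, Omega l z -> resV G lam w m z + k (fst z) = 0) /\
  (forall z, Sigma_0 z -> vy w z = v0 (snd z)) /\
  (forall z, W_minus l z \/ W_plus l z -> vy w z = 0).

(* [La], [Lb], [Lc] are the functions L^1, L^2, L^3 and [L1], [L2] the
   functions L_1, L_2. *)
Definition problem_d (l : R) (G : gas) (lam : R) (pl : R -> R)
    (La Lb Lc L1 L2 : R -> R) (w : flow) (m : field) (k : R -> R) : Prop :=
  (forall z, Omega l z ->
    Du w (Du_log_p G w) z
    - divergence (fun z => dx (pres w) z / rho w z)
                 (fun z => dy (pres w) z / rho w z) z
    - (dx (vx w) z ^ 2 + 2 * dy (vx w) z * dx (vy w) z + dy (vy w) z ^ 2)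
    - lam * (gamma G - 1) / 2 * Du w (fun z => m z * mach G w z ^ 2) z
    - lam * divergence (fun z => m z * vx w z) (fun z => m z * vy w z) z
    + La (resE G lam w m z) + Lb (resA G lam w m z)
    + Lc (resV G lam w m z + k (fst z)) = 0) /\
  (forall z, Sigma_0 z ->
    boundary_value l
      (fun z => resV G lam w m z + L1 (resE G lam w m z)
                + L2 (resA G lam w m z)) z 0) /\
  (forall z, Sigma_l l z -> pres w z = pl (snd z)) /\
  (forall z, W_minus l z \/ W_plus l z -> boundary_value l (dy (pres w)) z 0).

Definition coupled_problems (l : R) (G : gas) (lam : R)
    (E0 s0 v0 pl : R -> R) (La Lb Lc L1 L2 : R -> R)
    (w : flow) (m : field) (k : R -> R) : Prop :=
  problem_a l G lam E0 w m /\ problem_b l G lam s0 w m /\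
  problem_c l G lam v0 w m k /\ problem_d l G lam pl La Lb Lc L1 L2 w m k.

Definition problem_P (l : R) (G : gas) (lam : R) (E0 s0 v0 pl : R -> R)
    (w : flow) (m : field) : Prop :=
  (forall z, Omega l z ->
    divergence (fun z => rho w z * vx w z * vx w z)
               (fun z => rho w z * vx w z * vy w z) z + dx (pres w) z = 0 /\
    divergence (fun z => rho w z * vy w z * vx w z)
               (fun z => rho w z * vy w z * vy w z) z + dy (pres w) z = 0 /\
    divergence (fun z => rho w z * vx w z) (fun z => rho w z * vy w z) z
      = lam * rho w z * m z /\
    divergence (fun z => rho w z * enthalpy G w z * vx w z)
               (fun z => rho w z * enthalpy G w z * vy w z) z = 0) /\
  (forall z, Sigma_0 z ->
    enthalpy G w z = E0 (snd z) /\ entr w z = s0 (snd z) /\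
    vy w z = v0 (snd z)) /\
  (forall z, Sigma_l l z -> pres w z = pl (snd z)) /\
  (forall z, W_minus l z \/ W_plus l z -> vy w z = 0).

(* Main.v *)
(** Write X, Y for the residuals of the nonconservative momentum equations (divided
    by [rho]), and C for the residual of mass conservation divided by [rho], in
    which the material derivative of the density is traded for that of the
    pressure by means of [resA = 0].  Pointwise, [resE] is u X + v Y up to a
    multiple of [resA], [resV] is C - X / u, and the left-hand side of the
    pressure equation in (d), without the L^j, is D_u C - div (X, Y).  This settles the converse at once.

    If (a)-(d) hold, then X = - (v / u) Y and C = - (v / u^2) Y - k, and in
    D_u C = div (X, Y) the x-derivatives of Y cancel.  What is left is, for each
    x, the linear ordinary differential equation in y
      Y_y = alpha Y - u^3 / (u^2 + v^2) k'(x).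
    Y tends to 0 at both walls (v = 0 there forces its x-derivative to tend to
    0, and p_y tends to 0 by assumption), so Rolle's theorem applied to Y times
    the integrating factor gives k'(x) = 0, and then Y = 0.  Hence k is constant,
    and it is 0 by the condition on the inflow boundary. *)

From Stdlib Require Import Lra.
Require Import Defs.

(** * Partial derivatives *)

Definition line (b : bool) (z : R * R) (t : R) : R * R :=
  if b then (t, snd z) else (fst z, t).
Definition coord (b : bool) (z : R * R) : R := if b then fst z else snd z.

(* One boolean-indexed operator serves for both partial derivatives:
   [pd true] and [pd false] are convertible to [dx] and [dy]. *)
Definition pd (b : bool) (f : field) : field :=
  fun z => Derive (fun t => f (line b z t)) (coord b z).
Definition is_pd (b : bool) (f : field) (z : R * R) (a : R) : Prop :=
  is_derive (fun t => f (line b z t)) (coord b z) a.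
Definition ex_pd (b : bool) (f : field) (z : R * R) : Prop :=
  ex_derive (fun t => f (line b z t)) (coord b z).

Lemma line_coord b z : line b z (coord b z) = z.
Proof. destruct b, z; reflexivity. Qed.

Lemma pd_correct b f z : ex_pd b f z -> is_pd b f z (pd b f z).
Proof. apply Derive_correct. Qed.

Lemma is_pd_unique b f z a : is_pd b f z a -> pd b f z = a.
Proof. apply is_derive_unique. Qed.

Lemma is_pd_ex b f z a : is_pd b f z a -> ex_pd b f z.
Proof. intros H; exists a; exact H. Qed.

Lemma is_pd_const b c z : is_pd b (fun _ => c) z 0.
Proof. exact (is_derive_const c (coord b z)). Qed.

Lemma is_pd_plus b f g z df dg :
  is_pd b f z df -> is_pd b g z dg -> is_pd b (fun z => f z + g z) z (df + dg).
Proof. exact (is_derive_plus _ _ _ _ _). Qed.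

Lemma is_pd_opp b f z df : is_pd b f z df -> is_pd b (fun z => - f z) z (- df).
Proof. exact (is_derive_opp _ _ _). Qed.

Lemma is_pd_minus b f g z df dg :
  is_pd b f z df -> is_pd b g z dg -> is_pd b (fun z => f z - g z) z (df - dg).
Proof. exact (is_derive_minus _ _ _ _ _). Qed.

Lemma is_pd_mult b f g z df dg :
  is_pd b f z df -> is_pd b g z dg ->
  is_pd b (fun z => f z * g z) z (df * g z + f z * dg).
Proof.
  intros Hf Hg.
  generalize (is_derive_mult _ _ _ _ _ Hf Hg Rmult_comm).
  cbv beta; rewrite line_coord; exact (fun H => H).
Qed.

Lemma is_pd_div b f g z df dg :
  is_pd b f z df -> is_pd b g z dg -> g z <> 0 ->
  is_pd b (fun z => f z / g z) z ((df * g z - f z * dg) / g z ^ 2).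
Proof.
  intros Hf Hg Hz.
  rewrite <- (line_coord b z) in Hz.
  generalize (is_derive_div _ _ _ _ _ Hf Hg Hz).
  cbv beta; rewrite line_coord; exact (fun H => H).
Qed.

(** The derivative keeps the exponent [a] instead of [a - 1], so that in later identities the power
    of the density is a common factor that [field] treats as an atom. *)
Lemma is_derive_Rpower (g : R -> R) x d a :
  is_derive g x d -> 0 < g x ->
  is_derive (fun t => Rpower (g t) a) x (a * d / g x * Rpower (g x) a).
Proof.
  intros Hg Hx; unfold Rpower.
  auto_derive.
  - split; [exists d; exact Hg | auto].
  - change (fun t => g t) with g; rewrite (is_derive_unique _ _ _ Hg); field; lra.
Qed.

Lemma is_pd_Rpower b f z df a :
  is_pd b f z df -> 0 < f z ->
  is_pd b (fun z => Rpower (f z) a) z (a * df / f z * Rpower (f z) a).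
Proof.
  intros Hf Hz.
  rewrite <- (line_coord b z) in Hz.
  generalize (is_derive_Rpower _ _ _ a Hf Hz).
  cbv beta; rewrite line_coord; exact (fun H => H).
Qed.

Lemma is_pd_fst_true (k : R -> R) z d :
  is_derive k (fst z) d -> is_pd true (fun z => k (fst z)) z d.
Proof. exact (fun H => H). Qed.

Lemma is_pd_fst_false (k : R -> R) z : is_pd false (fun z => k (fst z)) z 0.
Proof. exact (is_derive_const (k (fst z)) (snd z)). Qed.

(** Structural differentiation: the value of the derivative is an existential variable filled in by
    the rules. Nonzero denominators and positive bases of [Rpower] remain as goals. *)
Ltac pd_rules :=
  lazymatch goal with
  | |- is_pd _ (fun _ => ?c) _ _ => apply is_pd_const
  | |- is_pd _ (fun z => @?f z + @?g z) _ _ => eapply is_pd_plus; pd_rules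
  | |- is_pd _ (fun z => @?f z - @?g z) _ _ => eapply is_pd_minus; pd_rules
  | |- is_pd _ (fun z => @?f z * @?g z) _ _ => eapply is_pd_mult; pd_rules
  | |- is_pd _ (fun z => @?f z / @?g z) _ _ =>
      eapply is_pd_div; [pd_rules | pd_rules | ]
  | |- is_pd _ (fun z => - @?f z) _ _ => eapply is_pd_opp; pd_rules
  | |- is_pd _ (fun z => Rpower (@?f z) _) _ _ => eapply is_pd_Rpower; [pd_rules | ]
  | |- is_pd _ _ _ _ => first [eassumption | eapply pd_correct; try eassumption]
  end.

(** * Locality on the open duct and symmetry of second derivatives *)

Lemma locally_Ioo a b x : a < x < b -> locally x (fun t => a < t < b).
Proof.
  intros [H1 H2].
  apply filter_and;
    [exact (open_gt a x H1) | exact (open_lt b x H2)].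
Qed.

Lemma locally_line l b z :
  Omega l z -> locally (coord b z) (fun t => Omega l (line b z t)).
Proof.
  destruct b, z as [x y]; intros [Hx Hy]; simpl in *.
  - apply (filter_imp (fun t => 0 < t < l));
      [intros t Ht; split; auto | apply locally_Ioo; auto].
  - apply (filter_imp (fun t => 0 < t < PI));
      [intros t Ht; split; auto | apply locally_Ioo; auto].
Qed.

Lemma locally_Omega l z : Omega l z -> locally z (Omega l).
Proof.
  destruct z as [x y]; intros [Hx Hy]; simpl in *.
  destruct (locally_Ioo _ _ _ Hx) as [d1 H1].
  destruct (locally_Ioo _ _ _ Hy) as [d2 H2].
  exists (mkposreal _ (Rmin_stable_in_posreal d1 d2)).
  intros [x' y'] [Bx By]; simpl in *; split; simpl.
  - apply H1; eapply ball_le; [|exact Bx]; apply Rmin_l.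
  - apply H2; eapply ball_le; [|exact By]; apply Rmin_r.
Qed.

(** Because the duct is open, a pointwise identity on it may be differentiated at each of its
    points. *)
Lemma pd_ext l b f g z :
  (forall z, Omega l z -> f z = g z) -> Omega l z -> pd b f z = pd b g z.
Proof.
  intros E Hz; apply Derive_ext_loc.
  generalize (locally_line l b z Hz); apply filter_imp; auto.
Qed.

Lemma is_pd_ext l b f g z a :
  (forall z, Omega l z -> f z = g z) -> Omega l z ->
  is_pd b f z a -> is_pd b g z a.
Proof.
  intros E Hz; apply is_derive_ext_loc.
  generalize (locally_line l b z Hz); apply filter_imp; auto.
Qed.

Lemma continuous_on_Omega l (f : field) z :
  continuous_on (Omega l) f -> Omega l z ->
  filterlim f (locally z) (locally (f z)).
Proof.
  intros H Hz P HP.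
  generalize (filter_and _ _ (locally_Omega l z Hz) (H z Hz P HP)).
  unfold filtermap, within; apply filter_imp; intros t [H1 H2]; auto.
Qed.

Lemma Ck_ex_pd l n f b z : Ck (Omega l) (S n) f -> Omega l z -> ex_pd b f z.
Proof. intros [_ [H _]] Hz; destruct b; apply (H z Hz). Qed.

Lemma Ck_pd l n f b : Ck (Omega l) (S n) f -> Ck (Omega l) n (pd b f).
Proof. intros [_ [_ [H1 H2]]]; destruct b; assumption. Qed.

Lemma Ck_continuous l n f z :
  Ck (Omega l) n f -> Omega l z -> filterlim f (locally z) (locally (f z)).
Proof.
  intros H; apply continuous_on_Omega; destruct n; apply H.
Qed.

(** Needed for the mixed derivatives of u and v, which D_u C and div (X, Y) produce in opposite
    orders. *)
Lemma pd_swap l f z : Ck (Omega l) 2 f -> Omega l z ->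
  pd true (pd false f) z = pd false (pd true f) z.
Proof.
  intros Hf Hz; destruct z as [x y].
  assert (C : forall b, filterlim (pd b (pd (negb b) f)) (locally (x, y))
                  (locally (pd b (pd (negb b) f) (x, y)))).
  { intros b; apply (Ck_continuous l 0); auto.
    apply Ck_pd, Ck_pd; exact Hf. }
  apply (Schwarz (fun s t => f (s, t)) x y).
  - apply locally_2d_locally.
    generalize (locally_Omega l _ Hz); apply filter_imp.
    intros [s t] Hst; simpl.
    repeat split.
    + exact (Ck_ex_pd l 1 f true (s, t) Hf Hst).
    + exact (Ck_ex_pd l 1 f false (s, t) Hf Hst).
    + exact (Ck_ex_pd l 0 (pd false f) true (s, t) (Ck_pd _ _ _ _ Hf) Hst).
    + exact (Ck_ex_pd l 0 (pd true f) false (s, t) (Ck_pd _ _ _ _ Hf) Hst).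
  - apply continuity_2d_pt_filterlim.
    eapply filterlim_ext; [|exact (C true)].
    intros [s t]; reflexivity.
  - apply continuity_2d_pt_filterlim.
    eapply filterlim_ext; [|exact (C false)].
    intros [s t]; reflexivity.
Qed.

(** * A linear differential equation vanishing at both ends *)

(** Setting [h] to [L] off the open interval gives a function that is continuous at both ends and
    has the same derivative inside; the classical theorem of Rolle applies to it. *)
Lemma Rolle_lim (h dh : R -> R) (a b L : R) :
  a < b ->
  (forall y, a < y < b -> is_derive h y (dh y)) ->
  filterlim h (at_right a) (locally L) ->
  filterlim h (at_left b) (locally L) ->
  exists c, a < c < b /\ dh c = 0.
Proof.
  intros Hab Hd Ha Hb.
  pose (g := fun y => if Rlt_dec a y then if Rlt_dec y b then h y else L else L).
  assert (gd : forall y, a < y < b -> is_derive g y (dh y)).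
  { intros y Hy; apply is_derive_ext_loc with (2 := Hd y Hy).
    generalize (locally_Ioo _ _ _ Hy); apply filter_imp; intros t Ht.
    unfold g; destruct (Rlt_dec a t), (Rlt_dec t b); lra. }
  assert (gL : forall y, ~ a < y < b -> g y = L).
  { intros y Hy; unfold g; destruct (Rlt_dec a y), (Rlt_dec y b); tauto. }
  assert (gc : forall y, a <= y <= b -> continuity_pt g y).
  { intros y Hy; apply continuity_pt_filterlim.
    destruct (Req_dec y a) as [-> | Hya]; [|destruct (Req_dec y b) as [-> | Hyb]].
    - intros P HP; rewrite gL in HP by lra.
      generalize (Ha P HP); unfold filtermap, at_right, within.
      apply filter_imp; intros t Ht.
      generalize (locally_singleton _ _ HP); intros HL.
      unfold g; destruct (Rlt_dec a t), (Rlt_dec t b); auto.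
    - intros P HP; rewrite gL in HP by lra.
      generalize (Hb P HP); unfold filtermap, at_left, within.
      apply filter_imp; intros t Ht.
      generalize (locally_singleton _ _ HP); intros HL.
      unfold g; destruct (Rlt_dec a t), (Rlt_dec t b); auto.
    - apply (ex_derive_continuous g y); exists (dh y); apply gd; lra. }
  (* The derivability proof carries [dh y] as its first component, so the derivative in Rolle's
     conclusion reduces to [dh c]. *)
  pose (pr := fun y Hy => exist (fun d => derivable_pt_abs g y d) (dh y)
                (proj1 (is_derive_Reals _ _ _) (gd y Hy)) : derivable_pt g y).
  destruct (Rolle g a b pr gc Hab) as [c [Hc E]].
  - rewrite !gL by lra; reflexivity.
  - exists c; split; auto.
Qed.

(* After multiplication by the integrating factor, the derivative has the sign
   of [- kap]; it vanishes somewhere by Rolle. *)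
Lemma linear_ode_vanishing (alpha c f : R -> R) (a b kap : R) :
  a < b ->
  (forall y, continuous alpha y) ->
  (forall y, a < y < b -> 0 < c y) ->
  (forall y, a < y < b -> is_derive f y (alpha y * f y - c y * kap)) ->
  filterlim f (at_right a) (locally 0) ->
  filterlim f (at_left b) (locally 0) ->
  kap = 0 /\ forall y, a < y < b -> f y = 0.
Proof.
  intros Hab Hal Hc Hf Ha Hb.
  pose (I := fun y => RInt alpha a y).
  assert (HI : forall y, is_derive I y (alpha y)).
  { intros y; apply (is_derive_RInt alpha I a y); [|apply Hal].
    apply filter_forall; intros t; apply (RInt_correct alpha).
    apply (ex_RInt_continuous alpha); auto. }
  pose (h := fun y => f y * exp (- I y)).
  assert (Hh : forall y, a < y < b -> is_derive h y (- c y * kap * exp (- I y))).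
  { intros y Hy; unfold h.
    generalize (Hf y Hy) (HI y); intros D1 D2.
    auto_derive.
    - split; [eexists; exact D1 | split; [eexists; exact D2 | auto]].
    - change (fun t => f t) with f; change (fun t => I t) with I.
      rewrite (is_derive_unique _ _ _ D1), (is_derive_unique _ _ _ D2); ring. }
  (* [I] is continuous at the ends too, so the integrating factor has a finite limit there and [h]
     inherits the limit 0 of [f]. *)
  assert (lim : forall F y, Filter F -> filter_le F (locally y) ->
                 filterlim f F (locally 0) -> filterlim h F (locally 0)).
  { intros F y FF HF H0.
    assert (E : filterlim (fun t => exp (- I t)) F (locally (exp (- I y)))).
    { eapply filterlim_filter_le_1; [exact HF|].
      apply (ex_derive_continuous (fun t => exp (- I t)) y).
      auto_derive; exists (alpha y); apply HI. }
    rewrite <- (Rmult_0_l (exp (- I y))).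
    exact (filterlim_comp_2 _ _ _ H0 E (filterlim_mult _ _)). }
  assert (ha : filterlim h (at_right a) (locally 0)).
  { apply (lim _ a); auto;
      [apply within_filter, locally_filter | apply filter_le_within]. }
  assert (hb : filterlim h (at_left b) (locally 0)).
  { apply (lim _ b); auto;
      [apply within_filter, locally_filter | apply filter_le_within]. }
  assert (K : kap = 0).
  { destruct (Rolle_lim h _ a b 0 Hab Hh ha hb) as [y [Hy E]].
    generalize (Hc y Hy) (exp_pos (- I y)); intros P1 P2.
    apply Rmult_integral in E; destruct E as [E|E]; [|lra].
    apply Rmult_integral in E; destruct E as [E|E]; lra. }
  split; [exact K|].
  intros y Hy.
  (* With [kap = 0] the derivative of [h] is zero, so [h] is constant up to [y], and its value is
     its limit 0 at [a]. *)
  assert (C : forall t, a < t < y -> h t = h y).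
  { intros t Ht; apply (eq_is_derive h t y); [|lra].
    intros s Hs; generalize (Hh s ltac:(lra)).
    rewrite K; replace (- c s * 0 * exp (- I s)) with 0 by ring; auto. }
  assert (Z : h y = 0).
  { apply (filterlim_locally_unique (F := at_right a) h); [|exact ha].
    apply filterlim_ext_loc with (fun _ => h y); [|apply filterlim_const].
    generalize (open_lt y a (proj1 Hy)); unfold at_right, within; apply filter_imp.
    intros t Ht1 Ht2; symmetry; apply C; split; auto. }
  unfold h in Z; apply Rmult_integral in Z.
  generalize (exp_pos (- I y)); lra.
Qed.

(** * Pointwise identities between the residuals *)

(** Squaring removes both roots: M^2 is rational in p, rho, u, v and can be differentiated by the
    quotient rule. *)
Lemma mach_sqr G w z :
  0 < gamma G -> 0 < pres w z -> 0 < rho w z ->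
  mach G w z ^ 2
    = rho w z * (vx w z * vx w z + vy w z * vy w z) / (gamma G * pres w z).
Proof.
  intros Hg Hp Hr; unfold mach, speed, sound.
  assert (S : 0 < gamma G * pres w z / rho w z).
  { apply Rdiv_lt_0_compat; auto; apply Rmult_lt_0_compat; auto. }
  generalize (sqrt_lt_R0 _ S); intros S'.
  unfold Rdiv at 1; rewrite Rpow_mult_distr, pow_inv.
  rewrite !pow2_sqrt; [field; lra | lra | ].
  generalize (pow2_ge_0 (vx w z)) (pow2_ge_0 (vy w z)); lra.
Qed.

Lemma enthalpy_eq G w z :
  1 < gamma G -> 0 < pres w z -> 0 < rho w z ->
  enthalpy G w z
    = / 2 * (vx w z * vx w z + vy w z * vy w z)
      + gamma G / (gamma G - 1) * (pres w z / rho w z).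
Proof.
  intros Hg Hp Hr; unfold enthalpy, speed, sound.
  rewrite !pow2_sqrt; [field; lra | | ].
  - apply Rlt_le, Rdiv_lt_0_compat; auto; apply Rmult_lt_0_compat; lra.
  - generalize (pow2_ge_0 (vx w z)) (pow2_ge_0 (vy w z)); lra.
Qed.

Section Balance_laws.

Context (l : R) (G : gas) (lam : R) (w : flow) (m : field).
Context (hgamma : 1 < gamma G) (hw : admissible l G w) (hm : C2_C1_bar l m).

(** The term lambda m u is what the mass source contributes when the conservative momentum equation
    is expanded and divided by rho. *)
Definition momentum_x : field :=
  fun z => Du w (vx w) z + lam * (m z * vx w z) + dx (pres w) z / rho w z.
Definition momentum_y : field :=
  fun z => Du w (vy w) z + lam * (m z * vy w z) + dy (pres w) z / rho w z.
Definition mass_residual : field :=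
  fun z => divergence (vx w) (vy w) z + Du w (rho w) z / rho w z - lam * m z.
(* [mass_residual], with the derivative of the density eliminated by means of
   [resA = 0]. *)
Definition mass_residual_p : field :=
  fun z => divergence (vx w) (vy w) z + Du_log_p G w z
    - lam * (gamma G - 1) / 2 * (m z * mach G w z ^ 2).

Lemma Omega_incl z : Omega l z -> Omega_bar l z.
Proof. unfold Omega, Omega_bar; lra. Qed.

Lemma flow_pos z :
  Omega_bar l z -> 0 < pres w z /\ 0 < rho w z /\ 0 < vx w z.
Proof. apply hw. Qed.

Lemma flow_C2 :
  Ck (Omega l) 2 (pres w) /\ Ck (Omega l) 2 (rho w) /\
  Ck (Omega l) 2 (vx w) /\ Ck (Omega l) 2 (vy w) /\ Ck (Omega l) 2 m.
Proof.
  destruct hw as (Hp & Hr & Hu & Hv & _).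
  exact (conj (proj1 Hp) (conj (proj1 Hr)
    (conj (proj1 Hu) (conj (proj1 Hv) (proj1 hm))))).
Qed.

Lemma flow_ex_pd b z : Omega l z ->
  ex_pd b (pres w) z /\ ex_pd b (rho w) z /\ ex_pd b (vx w) z /\
  ex_pd b (vy w) z /\ ex_pd b m z.
Proof.
  intros Hz; destruct flow_C2 as (Hp & Hr & Hu & Hv & Hm).
  split; [|split; [|split; [|split]]]; apply (Ck_ex_pd l 1); assumption.
Qed.

Lemma flow_ex_pd2 b b' z : Omega l z ->
  ex_pd b (pd b' (pres w)) z /\ ex_pd b (pd b' (vx w)) z /\
  ex_pd b (pd b' (vy w)) z.
Proof.
  intros Hz; destruct flow_C2 as (Hp & Hr & Hu & Hv & Hm).
  split; [|split]; apply (Ck_ex_pd l 0); try apply Ck_pd; assumption.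
Qed.

Lemma ex_pd_Du_log_p b z : Omega l z -> ex_pd b (Du_log_p G w) z.
Proof.
  intros Hz; destruct (flow_ex_pd b z Hz) as (Hp & Hr & Hu & Hv & Hm).
  destruct (flow_ex_pd2 b true z Hz) as (Hpx & _).
  destruct (flow_ex_pd2 b false z Hz) as (Hpy & _).
  eapply is_pd_ex; unfold Du_log_p, Du.
  change dx with (pd true); change dy with (pd false).
  pd_rules.
  destruct (flow_pos z (Omega_incl z Hz)) as (Pp & _).
  apply Rmult_integral_contrapositive; lra.
Qed.

Lemma ex_pd_m_mach b z :
  Omega l z -> ex_pd b (fun z => m z * mach G w z ^ 2) z.
Proof.
  intros Hz; destruct (flow_ex_pd b z Hz) as (Hp & Hr & Hu & Hv & Hm).
  eapply is_pd_ex, (is_pd_ext l b (fun z => m z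
    * (rho w z * (vx w z * vx w z + vy w z * vy w z) / (gamma G * pres w z))));
    [|exact Hz|].
  - intros z' Hz'; destruct (flow_pos z' (Omega_incl z' Hz')) as (Pp & Pr & _).
    rewrite mach_sqr by lra; reflexivity.
  - pd_rules.
    destruct (flow_pos z (Omega_incl z Hz)) as (Pp & _).
    apply Rmult_integral_contrapositive; lra.
Qed.

(** Dividing X by u produces u_x, which cancels the u_x of the divergence, and a term lambda m,
    which completes the bracket in [resV]. *)
Lemma resV_eq z : Omega_bar l z ->
  resV G lam w m z = mass_residual_p z - momentum_x z / vx w z.
Proof.
  intros Hz; destruct (flow_pos z Hz) as (Pp & Pr & Pu).
  unfold resV, mass_residual_p, momentum_x, divergence, Du.
  field; lra.
Qed.

(** The derivatives of m u and p_x / rho stay unexpanded, because they occur in this form in the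
    divergences of the pressure equation. *)
Lemma is_pd_momentum_x b z : Omega l z ->
  is_pd b momentum_x z
    (pd b (vx w) z * dx (vx w) z + vx w z * pd b (dx (vx w)) z
     + (pd b (vy w) z * dy (vx w) z + vy w z * pd b (dy (vx w)) z)
     + lam * pd b (fun z => m z * vx w z) z
     + pd b (fun z => dx (pres w) z / rho w z) z).
Proof.
  intros Hz; destruct (flow_ex_pd b z Hz) as (Hp & Hr & Hu & Hv & Hm).
  destruct (flow_ex_pd2 b true z Hz) as (Hpx & Hux & Hvx).
  destruct (flow_ex_pd2 b false z Hz) as (Hpy & Huy & Hvy).
  destruct (flow_pos z (Omega_incl z Hz)) as (Pp & Pr & Pu).
  change dx with (pd true) in *; change dy with (pd false) in *.
  assert (E1 : ex_pd b (fun z => m z * vx w z) z) by (eapply is_pd_ex; pd_rules).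
  assert (E2 : ex_pd b (fun z => pd true (pres w) z / rho w z) z)
    by (eapply is_pd_ex; pd_rules; lra).
  unfold momentum_x, Du.
  change dx with (pd true) in *; change dy with (pd false) in *.
  eapply is_pd_plus; [eapply is_pd_plus|apply pd_correct, E2]; [pd_rules|].
  generalize (is_pd_mult _ _ _ _ _ _ (is_pd_const b lam z) (pd_correct _ _ _ E1)).
  rewrite Rmult_0_l, Rplus_0_l; exact (fun H => H).
Qed.

Lemma is_pd_momentum_y b z : Omega l z ->
  is_pd b momentum_y z
    (pd b (vx w) z * dx (vy w) z + vx w z * pd b (dx (vy w)) z
     + (pd b (vy w) z * dy (vy w) z + vy w z * pd b (dy (vy w)) z)
     + lam * pd b (fun z => m z * vy w z) z
     + pd b (fun z => dy (pres w) z / rho w z) z).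
Proof.
  intros Hz; destruct (flow_ex_pd b z Hz) as (Hp & Hr & Hu & Hv & Hm).
  destruct (flow_ex_pd2 b true z Hz) as (Hpx & Hux & Hvx).
  destruct (flow_ex_pd2 b false z Hz) as (Hpy & Huy & Hvy).
  destruct (flow_pos z (Omega_incl z Hz)) as (Pp & Pr & Pu).
  change dx with (pd true) in *; change dy with (pd false) in *.
  assert (E1 : ex_pd b (fun z => m z * vy w z) z) by (eapply is_pd_ex; pd_rules).
  assert (E2 : ex_pd b (fun z => pd false (pres w) z / rho w z) z)
    by (eapply is_pd_ex; pd_rules; lra).
  unfold momentum_y, Du.
  change dx with (pd true) in *; change dy with (pd false) in *.
  eapply is_pd_plus; [eapply is_pd_plus|apply pd_correct, E2]; [pd_rules|].
  generalize (is_pd_mult _ _ _ _ _ _ (is_pd_const b lam z) (pd_correct _ _ _ E1)).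
  rewrite Rmult_0_l, Rplus_0_l; exact (fun H => H).
Qed.

Lemma is_pd_mass_residual_p b z : Omega l z ->
  is_pd b mass_residual_p z
    (pd b (dx (vx w)) z + pd b (dy (vy w)) z + pd b (Du_log_p G w) z
     - lam * (gamma G - 1) / 2 * pd b (fun z => m z * mach G w z ^ 2) z).
Proof.
  intros Hz.
  destruct (flow_ex_pd2 b true z Hz) as (_ & Hux & _).
  destruct (flow_ex_pd2 b false z Hz) as (_ & _ & Hvy).
  unfold mass_residual_p, divergence.
  change dx with (pd true) in *; change dy with (pd false) in *.
  eapply is_pd_minus.
  - eapply is_pd_plus; [pd_rules | apply pd_correct, ex_pd_Du_log_p, Hz].
  - generalize (is_pd_mult _ _ _ _ _ _
      (is_pd_const b (lam * (gamma G - 1) / 2) z)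
      (pd_correct _ _ _ (ex_pd_m_mach b z Hz))).
    rewrite Rmult_0_l, Rplus_0_l; exact (fun H => H).
Qed.

(** The second derivatives of the velocity occur alike in D_u C and in div (X, Y), up to the order
    of mixed derivatives, and cancel. What div (X, Y) leaves over is the quadratic expression in the
    velocity gradient. *)
Lemma pressure_equation_eq z : Omega l z ->
  Du w (Du_log_p G w) z
    - divergence (fun z => dx (pres w) z / rho w z)
                 (fun z => dy (pres w) z / rho w z) z
    - (dx (vx w) z ^ 2 + 2 * dy (vx w) z * dx (vy w) z + dy (vy w) z ^ 2)
    - lam * (gamma G - 1) / 2 * Du w (fun z => m z * mach G w z ^ 2) z
    - lam * divergence (fun z => m z * vx w z) (fun z => m z * vy w z) z
  = Du w mass_residual_p z - divergence momentum_x momentum_y z.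
Proof.
  intros Hz; destruct flow_C2 as (_ & _ & Cu & Cv & _).
  unfold Du at 1 2 3, divergence.
  generalize (pd_swap l _ z Cu Hz) (pd_swap l _ z Cv Hz).
  generalize (is_pd_unique _ _ _ _ (is_pd_momentum_x true z Hz))
    (is_pd_unique _ _ _ _ (is_pd_momentum_y false z Hz))
    (is_pd_unique _ _ _ _ (is_pd_mass_residual_p true z Hz))
    (is_pd_unique _ _ _ _ (is_pd_mass_residual_p false z Hz)).
  change dx with (pd true) in *; change dy with (pd false) in *.
  intros -> -> -> -> Su Sv; rewrite Su, Sv; ring.
Qed.

Lemma pd_enthalpy b z : Omega l z ->
  pd b (enthalpy G w) z
    = vx w z * pd b (vx w) z + vy w z * pd b (vy w) z
      + gamma G / (gamma G - 1)
        * ((pd b (pres w) z * rho w z - pres w z * pd b (rho w) z) / rho w z ^ 2).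
Proof.
  intros Hz; destruct (flow_ex_pd b z Hz) as (Hp & Hr & Hu & Hv & Hm).
  destruct (flow_pos z (Omega_incl z Hz)) as (Pp & Pr & Pu).
  rewrite (pd_ext l b _ (fun z => / 2 * (vx w z * vx w z + vy w z * vy w z)
      + gamma G / (gamma G - 1) * (pres w z / rho w z)) z); auto.
  - erewrite is_pd_unique; [|pd_rules; lra].
    cbv beta; field; lra.
  - intros z' Hz'; destruct (flow_pos z' (Omega_incl z' Hz')) as (Pp' & Pr' & _).
    apply enthalpy_eq; lra.
Qed.

(** This is the state equation solved for A(s); the derivatives of A(s) are obtained from those of p
    and rho through it. *)
Lemma A_field_eq z : Omega_bar l z ->
  A_field G w z = pres w z * Rpower (rho w z) (- gamma G).
Proof.
  intros Hz; destruct (flow_pos z Hz) as (Pp & Pr & Pu).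
  destruct hw as (_ & _ & _ & _ & _ & S).
  rewrite (S z Hz), Rmult_assoc, <- Rpower_plus, Rplus_opp_r, Rpower_O by lra.
  unfold A_field; ring.
Qed.

Lemma pd_A_field b z : Omega l z ->
  pd b (A_field G w) z
    = Rpower (rho w z) (- gamma G)
      * (pd b (pres w) z - gamma G * pres w z * pd b (rho w) z / rho w z).
Proof.
  intros Hz; destruct (flow_ex_pd b z Hz) as (Hp & Hr & _).
  destruct (flow_pos z (Omega_incl z Hz)) as (Pp & Pr & Pu).
  rewrite (pd_ext l b _ (fun z => pres w z * Rpower (rho w z) (- gamma G)) z);
    auto.
  - erewrite is_pd_unique; [|pd_rules; lra].
    cbv beta; field; lra.
  - intros z' Hz'; apply A_field_eq, Omega_incl, Hz'.
Qed.

Lemma resA_eq z : Omega l z ->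
  resA G lam w m z
    = Rpower (rho w z) (- gamma G)
      * (Du w (pres w) z - gamma G * pres w z * Du w (rho w) z / rho w z
         + lam * gamma G * m z * pres w z
         - lam * (gamma G - 1) / 2 * m z * rho w z
           * (vx w z * vx w z + vy w z * vy w z)).
Proof.
  intros Hz; destruct (flow_pos z (Omega_incl z Hz)) as (Pp & Pr & Pu).
  unfold resA, Du.
  generalize (pd_A_field true z Hz) (pd_A_field false z Hz).
  change (pd true) with dx; change (pd false) with dy; intros -> ->.
  rewrite A_field_eq, mach_sqr by (auto using Omega_incl; lra).
  field; lra.
Qed.

(** By the Gibbs relation, d(gamma p / ((gamma - 1) rho)) = dp / rho + rho^gamma dA(s) / ((gamma -
    1) rho). Hence D_u E splits into kinetic and pressure terms, collected in u X + v Y, and an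
    entropy term, collected in [resA]. *)
Lemma resE_eq z : Omega l z ->
  resE G lam w m z
    = vx w z * momentum_x z + vy w z * momentum_y z
      + resA G lam w m z
        / ((gamma G - 1) * rho w z * Rpower (rho w z) (- gamma G)).
Proof.
  intros Hz; destruct (flow_pos z (Omega_incl z Hz)) as (Pp & Pr & Pu).
  assert (K : 0 < Rpower (rho w z) (- gamma G)) by apply exp_pos.
  rewrite resA_eq by auto.
  unfold resE, momentum_x, momentum_y, Du.
  generalize (pd_enthalpy true z Hz) (pd_enthalpy false z Hz).
  change (pd true) with dx; change (pd false) with dy; intros -> ->.
  rewrite enthalpy_eq by lra.
  field; lra.
Qed.

(** Divided by gamma p rho^(-gamma), [resA] is D_u p / (gamma p) - D_u rho / rho plus source terms,
    which is exactly the exchange of the density derivative for the pressure derivative. *)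
Lemma mass_residual_p_eq z : Omega l z ->
  mass_residual_p z
    = mass_residual z
      + resA G lam w m z / (gamma G * pres w z * Rpower (rho w z) (- gamma G)).
Proof.
  intros Hz; destruct (flow_pos z (Omega_incl z Hz)) as (Pp & Pr & Pu).
  assert (K : 0 < Rpower (rho w z) (- gamma G)) by apply exp_pos.
  rewrite resA_eq by auto.
  unfold mass_residual_p, mass_residual, Du_log_p.
  rewrite mach_sqr by lra.
  field; lra.
Qed.

(** By the product rule, div (rho f u) = rho D_u f + f div (rho u). It is applied with f equal to u,
    v and E. *)
Lemma divergence_rho f z : Omega l z -> ex_pd true f z -> ex_pd false f z ->
  divergence (fun z => rho w z * f z * vx w z)
             (fun z => rho w z * f z * vy w z) z
    = rho w z * Du w f z + f z * rho w z * (mass_residual z + lam * m z).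
Proof.
  intros Hz F1 F2.
  destruct (flow_ex_pd true z Hz) as (Hp1 & Hr1 & Hu1 & Hv1 & _).
  destruct (flow_ex_pd false z Hz) as (Hp2 & Hr2 & Hu2 & Hv2 & _).
  destruct (flow_pos z (Omega_incl z Hz)) as (Pp & Pr & Pu).
  unfold mass_residual, divergence, Du.
  change dx with (pd true); change dy with (pd false).
  erewrite (is_pd_unique true); [|pd_rules].
  erewrite (is_pd_unique false (fun z => rho w z * f z * vy w z)); [|pd_rules].
  cbv beta; field; lra.
Qed.

Lemma divergence_mass z : Omega l z ->
  divergence (fun z => rho w z * vx w z) (fun z => rho w z * vy w z) z
    = rho w z * (mass_residual z + lam * m z).
Proof.
  intros Hz.
  destruct (flow_ex_pd true z Hz) as (Hp1 & Hr1 & Hu1 & Hv1 & _).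
  destruct (flow_ex_pd false z Hz) as (Hp2 & Hr2 & Hu2 & Hv2 & _).
  destruct (flow_pos z (Omega_incl z Hz)) as (Pp & Pr & Pu).
  unfold mass_residual, divergence, Du.
  change dx with (pd true); change dy with (pd false).
  erewrite (is_pd_unique true); [|pd_rules].
  erewrite (is_pd_unique false (fun z => rho w z * vy w z)); [|pd_rules].
  cbv beta; field; lra.
Qed.

Lemma ex_pd_enthalpy b z : Omega l z -> ex_pd b (enthalpy G w) z.
Proof.
  intros Hz; destruct (flow_ex_pd b z Hz) as (Hp & Hr & Hu & Hv & Hm).
  destruct (flow_pos z (Omega_incl z Hz)) as (Pp & Pr & Pu).
  eapply is_pd_ex, (is_pd_ext l b
    (fun z => / 2 * (vx w z * vx w z + vy w z * vy w z)
      + gamma G / (gamma G - 1) * (pres w z / rho w z))); [|exact Hz|].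
  - intros z' Hz'; destruct (flow_pos z' (Omega_incl z' Hz')) as (Pp' & Pr' & _).
    symmetry; apply enthalpy_eq; lra.
  - pd_rules; lra.
Qed.

(** Mass conservation comes first: once [mass_residual] vanishes, the left-hand sides of the other
    three equations are rho times the momentum and energy residuals. *)
Lemma problem_P_interior z : Omega l z ->
  (divergence (fun z => rho w z * vx w z * vx w z)
              (fun z => rho w z * vx w z * vy w z) z + dx (pres w) z = 0 /\
   divergence (fun z => rho w z * vy w z * vx w z)
              (fun z => rho w z * vy w z * vy w z) z + dy (pres w) z = 0 /\
   divergence (fun z => rho w z * vx w z) (fun z => rho w z * vy w z) z
     = lam * rho w z * m z /\
   divergence (fun z => rho w z * enthalpy G w z * vx w z)
              (fun z => rho w z * enthalpy G w z * vy w z) z = 0)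
  <->
  (mass_residual z = 0 /\ momentum_x z = 0 /\ momentum_y z = 0 /\
   resE G lam w m z = 0).
Proof.
  intros Hz.
  destruct (flow_ex_pd true z Hz) as (Hp1 & Hr1 & Hu1 & Hv1 & _).
  destruct (flow_ex_pd false z Hz) as (Hp2 & Hr2 & Hu2 & Hv2 & _).
  destruct (flow_pos z (Omega_incl z Hz)) as (Pp & Pr & Pu).
  rewrite divergence_mass, !divergence_rho by auto using ex_pd_enthalpy.
  assert (Ex : rho w z * momentum_x z
    = rho w z * Du w (vx w) z + vx w z * rho w z * (lam * m z) + dx (pres w) z)
    by (unfold momentum_x; field; lra).
  assert (Ey : rho w z * momentum_y z
    = rho w z * Du w (vy w) z + vy w z * rho w z * (lam * m z) + dy (pres w) z)
    by (unfold momentum_y; field; lra).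
  assert (Ee : rho w z * resE G lam w m z
    = rho w z * Du w (enthalpy G w) z
      + enthalpy G w z * rho w z * (lam * m z))
    by (unfold resE; ring).
  split.
  - intros (H1 & H2 & H3 & H4).
    assert (C : mass_residual z = 0) by (apply (Rmult_eq_reg_l (rho w z)); lra).
    rewrite C, Rplus_0_l in *.
    repeat split; apply (Rmult_eq_reg_l (rho w z)); lra.
  - intros (C & X & Y & E); rewrite C, X, Y, E, Rplus_0_l in *.
    repeat split; lra.
Qed.

End Balance_laws.

(** * Limits at the walls *)

Section Real_limits.

Context {T : Type} (F : (T -> Prop) -> Prop) {FF : Filter F}.

Lemma lim_plus (f g : T -> R) a b :
  filterlim f F (locally a) -> filterlim g F (locally b) ->
  filterlim (fun x => f x + g x) F (locally (a + b)).
Proof.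
  intros Hf Hg; exact (filterlim_comp_2 _ _ _ Hf Hg (filterlim_plus a b)).
Qed.

Lemma lim_mult (f g : T -> R) a b :
  filterlim f F (locally a) -> filterlim g F (locally b) ->
  filterlim (fun x => f x * g x) F (locally (a * b)).
Proof.
  intros Hf Hg; exact (filterlim_comp_2 _ _ _ Hf Hg (filterlim_mult a b)).
Qed.

Lemma lim_opp (f : T -> R) a :
  filterlim f F (locally a) -> filterlim (fun x => - f x) F (locally (- a)).
Proof. intros Hf; exact (filterlim_comp _ _ _ _ _ _ _ _ Hf (filterlim_opp a)). Qed.

Lemma lim_minus (f g : T -> R) a b :
  filterlim f F (locally a) -> filterlim g F (locally b) ->
  filterlim (fun x => f x - g x) F (locally (a - b)).
Proof. intros Hf Hg; exact (lim_plus _ _ _ _ Hf (lim_opp _ _ Hg)). Qed.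

Lemma lim_div (f g : T -> R) a b :
  filterlim f F (locally a) -> filterlim g F (locally b) -> b <> 0 ->
  filterlim (fun x => f x / g x) F (locally (a / b)).
Proof.
  intros Hf Hg Hb; apply lim_mult; [exact Hf|].
  apply (filterlim_comp _ _ _ g Rinv _ _ _ Hg).
  apply (ex_derive_continuous Rinv b); auto_derive; exact Hb.
Qed.

Lemma filterlim_within {U : Type} (f : T -> U) (D : U -> Prop)
    (H : (U -> Prop) -> Prop) :
  filterlim f F H -> F (fun t => D (f t)) -> filterlim f F (within D H).
Proof.
  intros Hf HD P HP.
  generalize (filter_and _ _ HD (Hf _ HP)).
  unfold filtermap; apply filter_imp; intros t [H1 H2]; auto.
Qed.

End Real_limits.

Ltac lim_rules :=
  lazymatch goal with
  | |- filterlim (fun z => @?f z + @?g z) _ _ =>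
      refine (lim_plus _ f g _ _ _ _); lim_rules
  | |- filterlim (fun z => @?f z - @?g z) _ _ =>
      refine (lim_minus _ f g _ _ _ _); lim_rules
  | |- filterlim (fun z => @?f z * @?g z) _ _ =>
      refine (lim_mult _ f g _ _ _ _); lim_rules
  | |- filterlim (fun z => @?f z / @?g z) _ _ =>
      refine (lim_div _ f g _ _ _ _ _); [lim_rules | lim_rules | ]
  | |- filterlim (fun _ => ?c) _ _ => exact (filterlim_const c)
  | |- _ => eassumption
  end.

Lemma filterlim_pair_locally (f g : R -> R) (F : (R -> Prop) -> Prop) (x y : R) :
  Filter F -> filterlim f F (locally x) -> filterlim g F (locally y) ->
  filterlim (fun t => (f t, g t)) F (locally (x, y)).
Proof.
  intros FF Hf Hg P [e He].
  pose proof (Hf _ (locally_ball x e) : F (fun t => ball x e (f t))) as Bf.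
  pose proof (Hg _ (locally_ball y e) : F (fun t => ball y e (g t))) as Bg.
  unfold filtermap; generalize (filter_and _ _ Bf Bg); apply filter_imp.
  intros t [H1 H2]; apply He; split; assumption.
Qed.

(** Composition with it extends a function on a closed cross-section to the whole line by its end
    values; [linear_ode_vanishing] asks for a coefficient that is continuous everywhere. *)
Definition clamp (a b t : R) : R := Rmax a (Rmin t b).

Lemma clamp_id a b t : a <= t <= b -> clamp a b t = t.
Proof.
  intros Ht; unfold clamp; rewrite Rmin_left, Rmax_right; lra.
Qed.

Lemma clamp_range a b t : a <= b -> a <= clamp a b t <= b.
Proof.
  intros H; unfold clamp, Rmax, Rmin.
  destruct (Rle_dec t b); destruct (Rle_dec a _); lra.
Qed.

Lemma clamp_lipschitz a b s t : Rabs (clamp a b s - clamp a b t) <= Rabs (s - t).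
Proof.
  unfold clamp, Rmax, Rmin.
  destruct (Rle_dec s b); destruct (Rle_dec t b);
    repeat destruct (Rle_dec a _); unfold Rabs;
    repeat destruct (Rcase_abs _); lra.
Qed.

Lemma clamp_continuous a b t : continuous (clamp a b) t.
Proof.
  intros P [e He]; exists e; intros s Hs; apply He.
  eapply Rle_lt_trans; [apply clamp_lipschitz | exact Hs].
Qed.

Lemma continuous_on_slice l (g : field) x t :
  continuous_on (Omega_bar l) g -> 0 <= x <= l ->
  filterlim (fun y => g (x, clamp 0 PI y)) (locally t)
    (locally (g (x, clamp 0 PI t))).
Proof.
  intros Hg Hx; pose proof PI_RGT_0 as Hpi.
  assert (D : forall y, Omega_bar l (x, clamp 0 PI y))
    by (intros y; split; [exact Hx | apply clamp_range; lra]).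
  apply (filterlim_comp _ _ _ (fun y => (x, clamp 0 PI y)) g _
           (within (Omega_bar l) (locally (x, clamp 0 PI t)))); [|apply Hg, D].
  apply filterlim_within; [apply locally_filter | | apply filter_forall, D].
  apply (filterlim_pair_locally (fun _ => x)); [apply locally_filter | | ].
  - apply filterlim_const.
  - apply clamp_continuous.
Qed.

Definition wall (b : R) : Prop := b = 0 \/ b = PI.

Lemma wall_Omega_bar l x b : 0 < x < l -> wall b -> Omega_bar l (x, b).
Proof.
  pose proof PI_RGT_0; intros Hx [-> | ->]; unfold Omega_bar; simpl; lra.
Qed.

Lemma wall_near (b : R) (P : R -> Prop) :
  wall b -> locally b P -> exists y, 0 < y < PI /\ P y.
Proof.
  intros Hb [e He]; pose proof PI_RGT_0 as Hpi; pose proof (cond_pos e) as He0.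
  (* A step of this length from either wall stays strictly inside the duct and closer than [e] to
     that wall. *)
  pose (d := Rmin e PI / 2).
  assert (Hd : 0 < d < PI /\ d < e)
    by (unfold d, Rmin; destruct (Rle_dec e PI); lra).
  destruct Hb as [-> | ->].
  - exists d; split; [lra|]; apply He.
    change (Rabs (d - 0) < e); rewrite Rabs_pos_eq; lra.
  - exists (PI - d); split; [lra|]; apply He.
    change (Rabs (PI - d - PI) < e); rewrite Rabs_left; lra.
Qed.

Lemma lim_Omega_of_closure l (g : field) z :
  continuous_on (Omega_bar l) g -> Omega_bar l z ->
  filterlim g (within (Omega l) (locally z)) (locally (g z)).
Proof.
  intros Hg Hz; eapply filterlim_filter_le_1; [|exact (Hg z Hz)].
  intros P; unfold within; apply filter_imp; intros t H1 H2.
  apply H1, Omega_incl, H2.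
Qed.

(* The mean value theorem in [x], at heights tending to the wall. *)
Lemma extension_dx_wall l (f h : field) x b :
  Ck (Omega l) 1 f -> continuous_on (Omega_bar l) f ->
  continuous_on (Omega_bar l) h -> (forall z, Omega l z -> h z = dx f z) ->
  wall b -> (forall s, 0 < s < l -> f (s, b) = 0) ->
  0 < x < l -> h (x, b) = 0.
Proof.
  intros C1 Cf Ch Eh Hb Hf Hx.
  destruct (Req_dec (h (x, b)) 0) as [E | N]; [exact E | exfalso].
  set (H := h (x, b)) in *.
  assert (HP : 0 < Rabs H) by (apply Rabs_pos_lt, N).
  assert (near : forall g z, continuous_on (Omega_bar l) g -> Omega_bar l z ->
    forall e, 0 < e -> exists d : posreal, forall z',
      Omega_bar l z' -> ball (fst z) d (fst z') -> ball (snd z) d (snd z') ->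
      Rabs (g z' - g z) < e).
  { intros g z Cg Hz e He.
    destruct (Cg z Hz _ (locally_ball (g z) (mkposreal e He))) as [d Hd].
    exists d; intros z' Hz' B1 B2; apply (Hd z' (conj B1 B2) Hz'). }
  destruct (near h (x, b) Ch (wall_Omega_bar _ _ _ Hx Hb) (Rabs H / 2))
    as [d Hd]; [lra|].
  pose proof (cond_pos d) as Hd0.
  (* A second abscissa, inside the duct and so close to [x] that [h] stays within |H| / 2 of [H]
     between the two. *)
  pose (x2 := x + Rmin d (l - x) / 2).
  assert (Hx2 : x < x2 < l /\ x2 < x + d)
    by (unfold x2, Rmin; destruct (Rle_dec d (l - x)); lra).
  (* At a height near the wall, [f] is smaller than this tolerance at both abscissas, so its
     increment is below |H| (x2 - x) / 4. The mean value theorem makes the increment at least |H|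
     (x2 - x) / 2, a contradiction. *)
  assert (He : 0 < Rabs H * (x2 - x) / 8)
    by (apply Rdiv_lt_0_compat; [apply Rmult_lt_0_compat|]; lra).
  destruct (near f (x, b) Cf (wall_Omega_bar _ _ _ Hx Hb) _ He) as [d1 Hd1].
  destruct (near f (x2, b) Cf (wall_Omega_bar l x2 b ltac:(lra) Hb) _ He)
    as [d2 Hd2].
  destruct (wall_near b (fun y => ball b d y /\ ball b d1 y /\ ball b d2 y) Hb)
    as [y [Hy (B & B1 & B2)]].
  { repeat apply filter_and; apply locally_ball. }
  destruct (MVT_gen (fun s => f (s, y)) x x2 (fun s => dx f (s, y)))
    as [c [Hc E]]; rewrite ?Rmin_left, ?Rmax_right in * by lra.
  - intros s Hs; apply (pd_correct true), (Ck_ex_pd l 0); [exact C1|].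
    split; simpl; lra.
  - intros s Hs; apply continuity_pt_filterlim,
      (ex_derive_continuous (fun s => f (s, y))).
    apply (Ck_ex_pd l 0 f true (s, y) C1); split; simpl; lra.
  - assert (Hc' : Omega l (c, y)) by (split; simpl; lra).
    rewrite <- Eh in E by exact Hc'.
    specialize (Hd (c, y) (Omega_incl _ _ Hc')).
    specialize (Hd1 (x, y) ltac:(split; simpl; lra) (ball_center x d1) B1).
    specialize (Hd2 (x2, y) ltac:(split; simpl; lra) (ball_center x2 d2) B2).
    rewrite (Hf x Hx) in Hd1; rewrite (Hf x2 ltac:(lra)) in Hd2.
    assert (Hc2 : Rabs (h (c, y) - H) < Rabs H / 2).
    { apply Hd; [|exact B]; change (Rabs (c - x) < d); rewrite Rabs_pos_eq; lra. }
    assert (Hc3 : Rabs H / 2 < Rabs (h (c, y))).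
    { generalize (Rabs_triang_inv H (h (c, y))).
      rewrite Rabs_minus_sym in Hc2; lra. }
    assert (L : Rabs H / 2 * (x2 - x) <= Rabs (h (c, y)) * (x2 - x))
      by (apply Rmult_le_compat_r; lra).
    rewrite <- (Rabs_pos_eq (x2 - x)) in L at 2 by lra.
    rewrite <- Rabs_mult, <- E in L.
    generalize (Rabs_triang (f (x2, y)) (- f (x, y))); rewrite Rabs_Ropp.
    rewrite Rminus_0_r in Hd1, Hd2; unfold Rminus at 2 in L; lra.
Qed.

Lemma lim_dx_wall l (f : field) x b :
  C1_bar l f -> wall b -> (forall s, 0 < s < l -> f (s, b) = 0) -> 0 < x < l ->
  filterlim (dx f) (within (Omega l) (locally (x, b))) (locally 0).
Proof.
  intros (C1 & Cf & (h & Ch & Eh) & _) Hb Hf Hx.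
  apply filterlim_within_ext with h; [exact Eh|].
  rewrite <- (extension_dx_wall l f h x b); auto.
  apply lim_Omega_of_closure; auto using wall_Omega_bar.
Qed.

(** Restricts limits over the open duct at a wall point to one-sided limits on the cross-section, as
    [linear_ode_vanishing] requires. *)
Lemma slice_y_right l x : 0 < x < l ->
  filterlim (fun y => (x, y)) (at_right 0) (within (Omega l) (locally (x, 0))).
Proof.
  intros Hx; apply filterlim_within; [apply within_filter, locally_filter | | ].
  - apply (filterlim_pair_locally (fun _ => x) (fun y => y));
      [apply within_filter, locally_filter | apply filterlim_const | ].
    apply filter_le_within.
  - generalize (open_lt PI 0 PI_RGT_0); unfold at_right, within; apply filter_imp.
    intros y H1 H2; split; simpl; lra.
Qed.

Lemma slice_y_left l x : 0 < x < l ->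
  filterlim (fun y => (x, y)) (at_left PI) (within (Omega l) (locally (x, PI))).
Proof.
  intros Hx; apply filterlim_within; [apply within_filter, locally_filter | | ].
  - apply (filterlim_pair_locally (fun _ => x) (fun y => y));
      [apply within_filter, locally_filter | apply filterlim_const | ].
    apply filter_le_within.
  - generalize (open_gt 0 PI PI_RGT_0); unfold at_left, within; apply filter_imp.
    intros y H1 H2; split; simpl; lra.
Qed.

Lemma slice_x_right l y : 0 < l -> 0 < y < PI ->
  filterlim (fun x => (x, y)) (at_right 0) (within (Omega l) (locally (0, y))).
Proof.
  intros Hl Hy; apply filterlim_within; [apply within_filter, locally_filter | | ].
  - apply (filterlim_pair_locally (fun x => x) (fun _ => y));
      [apply within_filter, locally_filter | | apply filterlim_const].
    apply filter_le_within.
  - generalize (open_lt l 0 Hl); unfold at_right, within; apply filter_imp.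
    intros x H1 H2; split; simpl; lra.
Qed.

Lemma zero_on_closed (k : R -> R) l :
  0 < l -> continuous_on (fun x => 0 <= x <= l) k ->
  (forall x, 0 < x < l -> k x = 0) -> forall x, 0 <= x <= l -> k x = 0.
Proof.
  intros Hl Ck Hk x Hx.
  destruct (Req_dec x 0) as [-> | N0]; [|destruct (Req_dec x l) as [-> | Nl]];
    [ | | apply Hk; lra].
  - apply (filterlim_locally_unique (F := at_right 0) k).
    + eapply filterlim_filter_le_1; [|exact (Ck 0 Hx)].
      intros P HP.
      generalize (filter_and _ _ (open_lt l 0 Hl) HP).
      unfold at_right, within; apply filter_imp; intros t [H1 H2] H3; apply H2; lra.
    + apply filterlim_ext_loc with (fun _ => 0); [|apply filterlim_const].
      generalize (open_lt l 0 Hl); unfold at_right, within; apply filter_imp.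
      intros t H1 H2; rewrite Hk; lra.
  - apply (filterlim_locally_unique (F := at_left l) k).
    + eapply filterlim_filter_le_1; [|exact (Ck l Hx)].
      intros P HP.
      generalize (filter_and _ _ (open_gt 0 l Hl) HP).
      unfold at_left, within; apply filter_imp; intros t [H1 H2] H3; apply H2; lra.
    + apply filterlim_ext_loc with (fun _ => 0); [|apply filterlim_const].
      generalize (open_gt 0 l Hl); unfold at_left, within; apply filter_imp.
      intros t H1 H2; rewrite Hk; lra.
Qed.

Section Walls.

Context (l : R) (G : gas) (lam : R) (w : flow) (m : field).
Context (hgamma : 1 < gamma G) (hw : admissible l G w) (hm : C2_C1_bar l m).

(** In u v_x + v v_y + lambda m v, the factors v and v_x tend to 0 at the wall, while u, m and v_y
    have finite limits. *)
Lemma lim_transport_wall x b :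
  wall b -> (forall s, 0 < s < l -> vy w (s, b) = 0) -> 0 < x < l ->
  filterlim (fun z => Du w (vy w) z + lam * (m z * vy w z))
    (within (Omega l) (locally (x, b))) (locally 0).
Proof.
  intros Hb Hv Hx.
  pose proof (wall_Omega_bar l x b Hx Hb) as Hz.
  destruct hw as (_ & _ & Cu & Cv & _).
  destruct Cv as (_ & Cv); pose proof Cv as (_ & cv & _ & (h & Ch & Eh)).
  destruct Cu as (_ & _ & cu & _).
  destruct hm as (_ & _ & cm & _).
  pose proof (lim_dx_wall l _ x b Cv Hb Hv Hx) as Lx.
  assert (Ly : filterlim (dy (vy w)) (within (Omega l) (locally (x, b)))
                 (locally (h (x, b)))).
  { apply filterlim_within_ext with h; [exact Eh|].
    apply lim_Omega_of_closure; auto. }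
  pose proof (lim_Omega_of_closure l _ _ cu Hz) as Lu.
  pose proof (lim_Omega_of_closure l _ _ cv Hz) as Lv.
  pose proof (lim_Omega_of_closure l _ _ cm Hz) as Lm.
  rewrite (Hv x Hx) in Lv.
  replace 0 with (vx w (x, b) * 0 + 0 * h (x, b) + lam * (m (x, b) * 0)) by ring.
  unfold Du.
  lim_rules.
Qed.

Lemma lim_momentum_y_wall x b :
  wall b -> (forall s, 0 < s < l -> vy w (s, b) = 0) -> 0 < x < l ->
  boundary_value l (dy (pres w)) (x, b) 0 ->
  filterlim (momentum_y lam w m) (within (Omega l) (locally (x, b))) (locally 0).
Proof.
  intros Hb Hv Hx Hp; unfold boundary_value in Hp.
  pose proof (wall_Omega_bar l x b Hx Hb) as Hz.
  pose proof (lim_transport_wall x b Hb Hv Hx) as L.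
  destruct (flow_pos l G w hw _ Hz) as (_ & Pr & _).
  destruct hw as (_ & Cr & _); destruct Cr as (_ & _ & cr & _).
  pose proof (lim_Omega_of_closure l _ _ cr Hz) as Lr.
  replace 0 with (0 + 0 / rho w (x, b)) by (field; lra).
  unfold momentum_y; refine (lim_plus _ _ _ _ _ L _).
  lim_rules; lra.
Qed.

(** Y = 0 gives p_y = - rho (D_u v + lambda m v), where the bracket tends to 0 at the wall. *)
Lemma boundary_dy_pressure_wall x b :
  wall b -> (forall s, 0 < s < l -> vy w (s, b) = 0) -> 0 < x < l ->
  (forall z, Omega l z -> momentum_y lam w m z = 0) ->
  boundary_value l (dy (pres w)) (x, b) 0.
Proof.
  intros Hb Hv Hx Hm; unfold boundary_value.
  pose proof (wall_Omega_bar l x b Hx Hb) as Hz.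
  pose proof (lim_transport_wall x b Hb Hv Hx) as L.
  assert (P := flow_pos l G w hw).
  destruct hw as (_ & Cr & _); destruct Cr as (_ & _ & cr & _).
  pose proof (lim_Omega_of_closure l _ _ cr Hz) as Lr.
  apply filterlim_within_ext with
    (fun z => - (rho w z * (Du w (vy w) z + lam * (m z * vy w z)))).
  - intros z Oz; generalize (Hm z Oz); unfold momentum_y.
    destruct (P z (Omega_incl _ _ Oz)) as (_ & Pr & _).
    intros E.
    replace (Du w (vy w) z + lam * (m z * vy w z))
      with (- (dy (pres w) z / rho w z)) by lra.
    field; lra.
  - replace 0 with (- (rho w (x, b) * 0)) by ring.
    exact (lim_opp _ _ _ (lim_mult _ _ _ _ _ Lr L)).
Qed.

End Walls.

(** * The auxiliary function *)

Section Auxiliary_function.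

Context (l : R) (G : gas) (lam : R) (w : flow) (m : field) (k dk : R -> R).
Context (hgamma : 1 < gamma G) (hw : admissible l G w) (hm : C2_C1_bar l m).
Context (hk : forall x, 0 < x < l -> is_derive k x (dk x)).
Context (hE : forall z, Omega l z -> resE G lam w m z = 0).
Context (hA : forall z, Omega l z -> resA G lam w m z = 0).
Context (hV : forall z, Omega l z -> resV G lam w m z + k (fst z) = 0).

(** With [resE] and [resA] zero, [resE_eq] leaves u X + v Y = 0, and u is positive. *)
Lemma momentum_x_of_y z : Omega l z ->
  momentum_x lam w m z = - (vy w z * momentum_y lam w m z / vx w z).
Proof.
  intros Hz; generalize (resE_eq l G lam w m hgamma hw hm z Hz).
  rewrite hE, hA by exact Hz.
  unfold Rdiv at 1; rewrite Rmult_0_l, Rplus_0_r; intros E.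
  destruct (flow_pos l G w hw z (Omega_incl _ _ Hz)) as (_ & _ & Pu).
  apply (Rmult_eq_reg_l (vx w z)); [|lra].
  replace (vx w z * - (vy w z * momentum_y lam w m z / vx w z))
    with (- (vy w z * momentum_y lam w m z)) by (field; lra); lra.
Qed.

Lemma mass_residual_p_of_y z : Omega l z ->
  mass_residual_p G lam w m z
    = - (vy w z * momentum_y lam w m z / (vx w z * vx w z)) - k (fst z).
Proof.
  intros Hz; generalize (resV_eq l G lam w m hw z (Omega_incl _ _ Hz)).
  rewrite momentum_x_of_y by exact Hz; intros E.
  destruct (flow_pos l G w hw z (Omega_incl _ _ Hz)) as (_ & _ & Pu).
  generalize (hV z Hz); rewrite E.
  replace (- (vy w z * momentum_y lam w m z / vx w z) / vx w z)
    with (- (vy w z * momentum_y lam w m z / (vx w z * vx w z)))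
    by (field; lra); lra.
Qed.

(* The [x]-derivatives of [momentum_y] cancel: the coupled system reduces to an
   ordinary differential equation in [y] on each cross-section. *)
Lemma momentum_y_ode z : Omega l z ->
  Du w (mass_residual_p G lam w m) z
    - divergence (momentum_x lam w m) (momentum_y lam w m) z = 0 ->
  is_pd false (momentum_y lam w m) z
    ((vy w z * dx (vx w) z - vy w z * dy (vy w) z
      + 2 * (vy w z * vy w z * dy (vx w) z) / vx w z)
     / (vx w z * vx w z + vy w z * vy w z) * momentum_y lam w m z
     - vx w z * vx w z * vx w z / (vx w z * vx w z + vy w z * vy w z)
       * dk (fst z)).
Proof.
  intros Hz D.
  destruct (flow_pos l G w hw z (Omega_incl _ _ Hz)) as (_ & _ & Pu).
  destruct (flow_ex_pd l G w m hw hm true z Hz) as (_ & _ & U1 & V1 & _).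
  destruct (flow_ex_pd l G w m hw hm false z Hz) as (_ & _ & U2 & V2 & _).
  assert (F1 := is_pd_ex _ _ _ _ (is_pd_momentum_y l G lam w m hw hm true z Hz)).
  assert (F2 := is_pd_ex _ _ _ _ (is_pd_momentum_y l G lam w m hw hm false z Hz)).
  assert (K1 : is_pd true (fun z => k (fst z)) z (dk (fst z)))
    by (apply is_pd_fst_true, hk, Hz).
  pose proof (is_pd_fst_false k z) as K2.
  set (f := momentum_y lam w m) in *.
  assert (X : dx (momentum_x lam w m) z
    = - (((pd true (vy w) z * f z + vy w z * pd true f z) * vx w z
          - vy w z * f z * pd true (vx w) z) / vx w z ^ 2)).
  { change dx with (pd true).
    rewrite (pd_ext l true _ _ z momentum_x_of_y Hz); fold f.
    apply is_pd_unique; pd_rules; lra. }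
  (* One formula for both directions: [d] is k' in the x-direction and 0 in the y-direction. *)
  assert (C : forall b d, is_pd b (fun z => k (fst z)) z d ->
      ex_pd b (vx w) z -> ex_pd b (vy w) z -> ex_pd b f z ->
      pd b (mass_residual_p G lam w m) z
    = - (((pd b (vy w) z * f z + vy w z * pd b f z) * (vx w z * vx w z)
          - vy w z * f z * (pd b (vx w) z * vx w z + vx w z * pd b (vx w) z))
         / (vx w z * vx w z) ^ 2) - d).
  { intros b d Hd Hu Hv Hf.
    rewrite (pd_ext l b _ _ z mass_residual_p_of_y Hz); fold f.
    apply is_pd_unique; pd_rules.
    apply Rmult_integral_contrapositive; lra. }
  generalize D; unfold Du, divergence.
  rewrite X.
  generalize (C true _ K1 U1 V1 F1) (C false _ K2 U2 V2 F2).
  change dx with (pd true); change dy with (pd false); intros -> -> D'.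
  match goal with |- is_pd _ _ _ ?a => replace a with (pd false f z) end.
  { apply pd_correct, F2. }
  assert (Q : 0 < vx w z * vx w z + vy w z * vy w z).
  { generalize (Rmult_lt_0_compat _ _ Pu Pu) (Rle_0_sqr (vy w z)).
    unfold Rsqr; lra. }
  (* Up to sign, this factor is the coefficient of Y_y in [D']: 1 comes from div (X, Y) and v^2 /
     u^2 from D_u C. *)
  apply (Rmult_eq_reg_l ((vx w z * vx w z + vy w z * vy w z) / (vx w z * vx w z))).
  2: { apply Rgt_not_eq, Rdiv_lt_0_compat; [|apply Rmult_lt_0_compat]; auto. }
  apply Rminus_diag_uniq; apply Ropp_eq_compat in D'.
  rewrite Ropp_0 in D'; rewrite <- D'.
  field; lra.
Qed.

Context (hD : forall z, Omega l z ->
  Du w (mass_residual_p G lam w m) z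
    - divergence (momentum_x lam w m) (momentum_y lam w m) z = 0).
Context (hv : forall z, W_minus l z \/ W_plus l z -> vy w z = 0).
Context (hp : forall z, W_minus l z \/ W_plus l z ->
  boundary_value l (dy (pres w)) z 0).

(** The equation of [momentum_y_ode] is solved on a fixed cross-section. For its coefficient to be
    continuous on the whole line, derivatives of u and v are replaced by their continuous extensions
    to the closed duct and the height is clamped; nothing changes at interior heights. *)
Lemma momentum_y_vanishes x : 0 < x < l ->
  dk x = 0 /\ forall y, 0 < y < PI -> momentum_y lam w m (x, y) = 0.
Proof.
  intros Hx.
  assert (P := flow_pos l G w hw).
  destruct hw as (_ & _ & Cu & Cv & _).
  destruct Cu as (_ & _ & cu & (ux & cux & Eux) & (uy & cuy & Euy)).
  destruct Cv as (_ & _ & cv & _ & (vy' & cvy & Evy)).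
  assert (vb : forall b, wall b -> forall s, 0 < s < l -> vy w (s, b) = 0).
  { intros b [-> | ->] s Hs; apply hv; [left | right]; split; auto. }
  assert (pb : forall b, wall b -> boundary_value l (dy (pres w)) (x, b) 0).
  { intros b [-> | ->]; apply hp; [left | right]; split; auto. }
  pose (S := fun (g : field) y => g (x, clamp 0 PI y)).
  assert (Sc : forall g, continuous_on (Omega_bar l) g ->
            forall t, filterlim (S g) (locally t) (locally (S g t))).
  { intros g Cg t; apply (continuous_on_slice l); [exact Cg | lra]. }
  assert (Pu : forall t, 0 < S (vx w) t).
  { intros t; apply P; split; [simpl; lra | apply clamp_range].
    generalize PI_RGT_0; lra. }
  assert (Q : forall u v, 0 < u -> 0 < u * u + v * v).
  { intros u v Hu; generalize (Rmult_lt_0_compat _ _ Hu Hu) (Rle_0_sqr v).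
    unfold Rsqr; lra. }
  apply (linear_ode_vanishing
    (fun y => (S (vy w) y * S ux y - S (vy w) y * S vy' y
               + 2 * (S (vy w) y * S (vy w) y * S uy y) / S (vx w) y)
              / (S (vx w) y * S (vx w) y + S (vy w) y * S (vy w) y))
    (fun y => vx w (x, y) * vx w (x, y) * vx w (x, y)
              / (vx w (x, y) * vx w (x, y) + vy w (x, y) * vy w (x, y)))).
  - exact PI_RGT_0.
  - intros t; unfold continuous.
    pose proof (Sc _ cu t); pose proof (Sc _ cv t); pose proof (Sc _ cux t).
    pose proof (Sc _ cuy t); pose proof (Sc _ cvy t).
    pose proof (Pu t) as Put; pose proof (Q _ (S (vy w) t) Put).
    lim_rules; lra.
  - intros y Hy.
    assert (Pxy : 0 < vx w (x, y)) by (apply P; split; simpl; lra).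
    apply Rdiv_lt_0_compat; [|apply Q, Pxy].
    repeat apply Rmult_lt_0_compat; exact Pxy.
  - intros y Hy.
    assert (Hz : Omega l (x, y)) by (split; simpl; lra).
    generalize (momentum_y_ode (x, y) Hz (hD _ Hz)); unfold is_pd; simpl.
    unfold S; rewrite !clamp_id by lra.
    rewrite Eux, Euy, Evy by exact Hz.
    exact (fun H => H).
  - eapply filterlim_comp; [apply slice_y_right, Hx|].
    apply (lim_momentum_y_wall l G); auto; [| apply vb | apply pb]; left; auto.
  - eapply filterlim_comp; [apply slice_y_left, Hx|].
    apply (lim_momentum_y_wall l G); auto; [| apply vb | apply pb]; right; auto.
Qed.

End Auxiliary_function.

(** * Equivalence of the coupled problems and the boundary value problem *)

Lemma A_of_inj G s t :
  0 < kappa0 G -> 0 < cnu G -> A_of G s = A_of G t -> s = t.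
Proof.
  intros Hk Hc; unfold A_of; intros E.
  apply Rmult_eq_reg_l in E; [|lra].
  apply exp_inv in E.
  apply (Rmult_eq_reg_r (/ cnu G)); [exact E | apply Rinv_neq_0_compat; lra].
Qed.

Theorem lemma3p1
  (l : R) (hl : 0 < l)
  (G : gas) (hgamma : 1 < gamma G) (hkappa0 : 0 < kappa0 G) (hcnu : 0 < cnu G)
  (lam : R)
  (E0 s0 v0 pl : R -> R)
  (La Lb Lc L1 L2 : R -> R)
  (sLa : smooth La) (sLb : smooth Lb) (sLc : smooth Lc)
  (sL1 : smooth L1) (sL2 : smooth L2)
  (La0 : La 0 = 0) (Lb0 : Lb 0 = 0) (Lc0 : Lc 0 = 0)
  (L10 : L1 0 = 0) (L20 : L2 0 = 0) :
  (forall (w : flow) (m : field) (k : R -> R),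
     admissible l G w -> C2_C1_bar l m -> C1_interval l k ->
     coupled_problems l G lam E0 s0 v0 pl La Lb Lc L1 L2 w m k ->
     (forall x, 0 <= x <= l -> k x = 0) /\
     problem_P l G lam E0 s0 v0 pl w m)
  /\
  (forall (w : flow) (m : field),
     C2_C1_bar l m -> admissible l G w ->
     problem_P l G lam E0 s0 v0 pl w m ->
     coupled_problems l G lam E0 s0 v0 pl La Lb Lc L1 L2 w m (fun _ => 0)).
Proof.
  split.
  - intros w m k hw hm (kc & dk & _ & hk)
      ((hE & bE) & (hA & bA) & (hV & bv & hv) & (hD & b0 & bl & bp)).
    (* In the duct each L^j is evaluated at 0, so (d) reduces to D_u C = div (X, Y). *)
    assert (hD' : forall z, Omega l z ->
      Du w (mass_residual_p G lam w m) z
        - divergence (momentum_x lam w m) (momentum_y lam w m) z = 0).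
    { intros z Hz; rewrite <- (pressure_equation_eq l G) by auto.
      generalize (hD z Hz); rewrite hE, hA, hV, La0, Lb0, Lc0 by exact Hz; lra. }
    assert (V := momentum_y_vanishes l G lam w m k dk hgamma hw hm hk hE hA hV
                   hD' hv bp).
    assert (Y : forall z, Omega l z -> momentum_y lam w m z = 0).
    { intros [x y] [Hx Hy]; apply (V x Hx); exact Hy. }
    assert (K : forall x, 0 < x < l -> k x = k (l / 2)).
    { assert (L : forall s t, 0 < s < l -> 0 < t < l -> s < t -> k s = k t).
      { intros s t Hs Ht Hst; apply (eq_is_derive k); [|exact Hst].
        intros r Hr; assert (Hr' : 0 < r < l) by lra.
        generalize (hk r Hr'); rewrite (proj1 (V r Hr')); exact (fun H => H). }
      intros x Hx; destruct (Rtotal_order x (l / 2)) as [H | [-> | H]];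
        [apply L | | symmetry; apply L]; auto; lra. }
    (* Along the line y = pi / 2 the inflow expression equals [- k], a constant, while its limit at
       the inflow boundary is 0. *)
    assert (K0 : k (l / 2) = 0).
    { pose proof PI_RGT_0 as Hpi.
      assert (B := b0 (0, PI / 2) ltac:(split; simpl; lra)).
      assert (B' := filterlim_comp _ _ _ _ _ _ _ _
                (slice_x_right l (PI / 2) hl ltac:(lra)) B).
      enough (- k (l / 2) = 0) by lra.
      apply (filterlim_locally_unique (F := at_right 0) _ _ _) with (2 := B').
      apply filterlim_ext_loc with (fun _ => - k (l / 2)); [|apply filterlim_const].
      generalize (open_lt l 0 hl); unfold at_right, within; apply filter_imp.
      intros x Hx1 Hx2; assert (Hz : Omega l (x, PI / 2)) by (split; simpl; lra).
      generalize (hV _ Hz); rewrite hE, hA, L10, L20 by exact Hz; simpl.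
      rewrite (K x ltac:(lra)); lra. }
    assert (Kz : forall x, 0 < x < l -> k x = 0)
      by (intros x Hx; rewrite K; auto).
    split; [apply zero_on_closed; auto|].
    split; [|split; [|split]]; auto.
    + intros z Hz; apply (problem_P_interior l G lam w m hgamma hw hm z Hz).
      assert (X := momentum_x_of_y l G lam w m hgamma hw hm hE hA z Hz).
      assert (C := mass_residual_p_of_y l G lam w m k hgamma hw hm hE hA hV z Hz).
      rewrite Y in X, C by exact Hz.
      rewrite (mass_residual_p_eq l G), hA, Kz in C by (auto; apply Hz).
      repeat split; auto; [|rewrite X]; unfold Rdiv in *; lra.
    + intros z Hz; repeat split; auto.
      (* The inflow condition in (b) prescribes A(s); injectivity of A recovers s. *)
      apply (A_of_inj G); auto; apply bA, Hz.
  - intros w m hm hw (hP & b0 & bl & hv).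
    assert (H := fun z Hz => proj1
      (problem_P_interior l G lam w m hgamma hw hm z Hz) (hP z Hz)).
    assert (Y : forall z, Omega l z -> momentum_y lam w m z = 0)
      by (intros z Hz; apply (H z Hz)).
    assert (X : forall z, Omega l z -> momentum_x lam w m z = 0)
      by (intros z Hz; apply (H z Hz)).
    assert (hE : forall z, Omega l z -> resE G lam w m z = 0)
      by (intros z Hz; apply (H z Hz)).
    (* Energy and momentum balance together leave only the [resA] term of [resE_eq], whose
       denominator is positive. *)
    assert (hA : forall z, Omega l z -> resA G lam w m z = 0).
    { intros z Hz; generalize (resE_eq l G lam w m hgamma hw hm z Hz).
      rewrite hE, X, Y by exact Hz; intros E.
      destruct (flow_pos l G w hw z (Omega_incl _ _ Hz)) as (_ & Pr & _).
      assert (D : 0 < (gamma G - 1) * rho w z * Rpower (rho w z) (- gamma G)).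
      { repeat apply Rmult_lt_0_compat; auto; [lra | apply exp_pos]. }
      apply (Rmult_eq_reg_r
        (/ ((gamma G - 1) * rho w z * Rpower (rho w z) (- gamma G))));
        [unfold Rdiv in E; lra | apply Rinv_neq_0_compat; lra]. }
    assert (C : forall z, Omega l z -> mass_residual_p G lam w m z = 0).
    { intros z Hz; rewrite (mass_residual_p_eq l G) by auto.
      rewrite (proj1 (H z Hz)), hA by exact Hz; unfold Rdiv; ring. }
    assert (hV : forall z, Omega l z -> resV G lam w m z = 0).
    { intros z Hz; rewrite (resV_eq l G) by auto using Omega_incl.
      rewrite C, X by exact Hz; unfold Rdiv; ring. }
    split; [|split; [|split]].
    + split; [exact hE | intros z Hz; apply b0, Hz].
    + split; [exact hA|].
      intros z Hz; unfold A_field; rewrite (proj1 (proj2 (b0 z Hz))); reflexivity.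
    + split; [|split; [|exact hv]].
      * intros z Hz; rewrite hV by exact Hz; ring.
      * intros z Hz; apply b0, Hz.
    + split; [|split; [|split]]; auto.
      * intros z Hz; rewrite (pressure_equation_eq l G) by auto.
        rewrite hE, hA, hV, Rplus_0_r, La0, Lb0, Lc0 by exact Hz.
        (* C, X and Y vanish throughout the open duct, hence so do the derivatives of each. *)
        unfold Du, divergence; change dx with (pd true); change dy with (pd false).
        rewrite (pd_ext l _ _ _ z C Hz), (pd_ext l _ _ _ z X Hz),
          (pd_ext l _ _ _ z Y Hz), (pd_ext l _ _ _ z C Hz).
        rewrite !(is_pd_unique _ _ _ _ (is_pd_const _ 0 z)); ring.
      (* The inflow expression is identically zero inside the duct, so its limit is 0. *)
      * intros z Hz; unfold boundary_value.
        apply filterlim_within_ext with (fun _ => 0); [|apply filterlim_const].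
        intros z' Hz'; rewrite hV, hE, hA, L10, L20 by exact Hz'; ring.
      * intros [x b] Hz.
        assert (Hb : wall b /\ 0 < x < l)
          by (destruct Hz as [[Hx Hb] | [Hx Hb]]; split; auto; [left | right]; auto).
        destruct Hb as [Hb Hx].
        apply (boundary_dy_pressure_wall l G lam w m); auto.
        intros s Hs; apply hv.
        destruct Hb as [-> | ->]; [left | right]; split; auto.
Qed.
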